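(* Let $u\colon A\to B$ and $f\colon B\to A$ be functors between quasi-categories. If there is a fibred equivalence over $A\times B$ between $(p_1,p_0)\colon f\downarrow A\to A\times B$ and $(q_1,q_0)\colon B\downarrow u\to A\times B$, then $f$ is left adjoint to $u$ (in the 2-category $\mathrm{qCat}_2$).
   Context: A quasi-category is a simplicial set with fillers for all inner horns; functors are simplicial maps between quasi-categories. $\mathrm{qCat}_2$ is the strict 2-category of quasi-categories with hom-categories $\hom'(A,B)=h(B^A)$, where $B^A$ is the internal hom and $h\colon\mathrm{sSet}\to\mathrm{Cat}$ is left adjoint to the nerve. Adjunctions of quasi-categories are adjunctions in $\mathrm{qCat}_2$ (unit $\eta\colon\mathrm{id}_B\Rightarrow uf$ and counit $\epsilon\colon fu\Rightarrow\mathrm{id}_A$ satisfying the triangle identities). Comma quasi-categories: $f\downarrow A$ is the pullback of $(\mathrm{cod},\mathrm{dom})\colon A^{\Delta^1}\to A\times A$ along $\mathrm{id}_A\times f\colon A\times B\to A\times A$, and $B\downarrow u$ is the pullback of $(\mathrm{cod},\mathrm{dom})\colon B^{\Delta^1}\to B\times B$ along $u\times\mathrm{id}_B\colon A\times B\to B\times B$; the projections to $A\times B$ are denoted $(p_1,p_0)$ and $(q_1,q_0)$, and both are isofibrations. Fibred equivalence: for isofibrations $p\colon E\to Q$, $q\colon F\to Q$ of quasi-categories, a fibred equivalence over $Q$ is a functor $w\colon E\to F$ with $qw=p$ for which there exist a functor $w'\colon F\to E$ with $pw'=q$ and isomorphisms $w'w\cong\mathrm{id}_E$ in $E^E$ and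 $\mathrm{id}_F\cong ww'$ in $F^F$ represented by 1-simplices whose composites with $p$ and $q$ respectively are degenerate. (A 1-simplex of a quasi-category is an isomorphism if it represents an isomorphism in the homotopy category.) This is the same as a functor over $Q$ that is an equivalence in $\mathrm{qCat}_2$. *)

(* Defs.v *)
From HB Require Import structures.
From mathcomp Require Import all_boot.
From mathcomp Require Import boolp.

Set Implicit Arguments.
Unset Strict Implicit.
Unset Printing Implicit Defensive.

Local Open Scope quotient_scope.

Reserved Notation "g \oc f" (at level 50, left associativity).
Reserved Notation "g \os f" (at level 50, left associativity).

Record category := Category {
  ob :> Type;
  hom : ob -> ob -> Type;
  idc : forall x, hom x x;
  comp : forall x y z, hom y z -> hom x y -> hom x z;
  comp1f : forall x y (f : hom x y), comp (idc y) f = f;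
  compf1 : forall x y (f : hom x y), comp f (idc x) = f;
  compA : forall x y z t (h : hom z t) (g : hom y z) (f : hom x y),
    comp h (comp g f) = comp (comp h g) f }.

Arguments hom {c}.
Arguments idc {c}.
Arguments comp {c x y z}.
Notation "g \oc f" := (comp g f).

Definition is_iso (C : category) (x y : C) (f : hom x y) : Prop :=
  exists g : hom y x, g \oc f = idc x /\ f \oc g = idc y.

(* The identity of [x], seen as a morphism to [y] along an equality of objects;
   needed because hom-sets are dependent types. *)
Definition eqhom (C : category) (x y : C) (e : x = y) : hom x y :=
  match e with erefl => idc x end.

Lemma eqhom_id (C : category) (x : C) (e : x = x) : eqhom e = idc x.
Proof. by rewrite (Prop_irrelevance e erefl). Qed.

Lemma eqhom_comp (C : category) (x y z : C) (e : x = y) (e' : y = z) :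
  eqhom e' \oc eqhom e = eqhom (etrans e e').
Proof. by case: z / e'; case: y / e; rewrite comp1f. Qed.

Record functor (C D : category) := Functor {
  fob :> C -> D;
  fmor : forall x y, hom x y -> hom (fob x) (fob y);
  fmor1 : forall x, fmor (idc x) = idc (fob x);
  fmorM : forall x y z (g : hom y z) (f : hom x y),
    fmor (g \oc f) = fmor g \oc fmor f }.

Arguments fmor {C D} f {x y} _ : rename.

Definition functor_comp (C D E : category) (G : functor D E) (F : functor C D) :
  functor C E.
Proof.
exists (fun x => G (F x)) (fun x y f => fmor G (fmor F f)).
- abstract (by move=> x; rewrite !fmor1).
- abstract (by move=> x y z g f; rewrite !fmorM).
Defined.

Lemma functor_ext (C D : category) (F G : functor C D) (e : forall x, F x = G x) :
  (forall x y (f : hom x y),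
     eqhom (e y) \oc fmor F f = fmor G f \oc eqhom (e x)) -> F = G.
Proof.
case: F G e => [Fo Fm F1 FM] [Go Gm G1 GM] /= e H.
have eo : Fo = Go by apply: funext.
subst Go.
have em : Fm = Gm.
  apply: functional_extensionality_dep => x.
  apply: functional_extensionality_dep => y.
  apply: functional_extensionality_dep => f.
  move: (H x y f); rewrite (Prop_irrelevance (e x) erefl).
  by rewrite (Prop_irrelevance (e y) erefl) /= comp1f compf1.
by subst Gm; congr Functor; apply: Prop_irrelevance.
Qed.

(* Morphisms [m] -> [n] of the simplex category, where [n] = {0 < ... < n}
   is ['I_n.+1] *)
Record mono (m n : nat) := Mono {
  mono_fun :> 'I_m.+1 -> 'I_n.+1;
  mono_homo : {homo mono_fun : i j / i <= j} }.

Lemma mono_ext m n (a b : mono m n) : a =1 b -> a = b.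
Proof.
case: a b => [a ha] [b hb] /= /funext e; subst b.
by congr Mono; apply: Prop_irrelevance.
Qed.

Definition mono_id n : mono n n := @Mono n n id (fun _ _ h => h).

Definition mono_comp m n p (b : mono n p) (a : mono m n) : mono m p :=
  Mono (fun i j (h : i <= j) => mono_homo b (mono_homo a h)).

Definition mono_const m n (i : 'I_n.+1) : mono m n :=
  @Mono m n (fun _ => i) (fun _ _ _ => leqnn i).

Definition coface n (i : 'I_n.+2) : mono n n.+1.
Proof. by exists (lift i) => j k; abstract (by rewrite /= leq_bump2). Defined.

Record sset := SSet {
  simp :> nat -> Type;
  act : forall m n, mono m n -> simp n -> simp m;
  act_id : forall n (x : simp n), act (mono_id n) x = x;
  act_comp : forall m n p (b : mono n p) (a : mono m n) (x : simp p),
    act (mono_comp b a) x = act a (act b x) }.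

Arguments act {s m n}.

Record smap (X Y : sset) := SMap {
  smap_fun :> forall n, X n -> Y n;
  smap_nat : forall m n (a : mono m n) (x : X n),
    smap_fun (act a x) = act a (smap_fun x) }.

Lemma smap_ext (X Y : sset) (f g : smap X Y) :
  (forall n (x : X n), f n x = g n x) -> f = g.
Proof.
case: f g => [f hf] [g hg] /= H.
have e : f = g.
  apply: functional_extensionality_dep => n.
  exact/functional_extensionality_dep/H.
by subst g; congr SMap; apply: Prop_irrelevance.
Qed.

Definition sid (X : sset) : smap X X := @SMap X X (fun _ x => x) (fun _ _ _ _ => erefl).

Definition scomp (X Y Z : sset) (g : smap Y Z) (f : smap X Y) : smap X Z.
Proof.
exists (fun n x => g n (f n x)).
abstract (by move=> m n a x; rewrite !smap_nat).
Defined.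

Notation "g \os f" := (scomp g f).

Lemma scompA (X Y Z T : sset) (h : smap Z T) (g : smap Y Z) (f : smap X Y) :
  h \os (g \os f) = h \os g \os f.
Proof. exact: smap_ext. Qed.

Lemma scomp1f (X Y : sset) (f : smap X Y) : sid Y \os f = f.
Proof. exact: smap_ext. Qed.

Lemma scompf1 (X Y : sset) (f : smap X Y) : f \os sid X = f.
Proof. exact: smap_ext. Qed.

Definition face (X : sset) n (i : 'I_n.+2) (x : X n.+1) : X n := act (coface i) x.

(* The source of a 1-simplex is its face d1, the target its face d0 *)
Definition src (X : sset) (e : X 1) : X 0 := face (ord_max : 'I_2) e.
Definition tgt (X : sset) (e : X 1) : X 0 := face (ord0 : 'I_2) e.
Definition s0 (X : sset) (x : X 0) : X 1 := act (mono_const 1 (ord0 : 'I_1)) x.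

Definition simplex (n : nat) : sset.
Proof.
exists (fun m => mono m n) (fun m p a s => mono_comp s a).
- abstract (by move=> m s; apply: mono_ext).
- abstract (by move=> m p q b a s; apply: mono_ext).
Defined.

Definition simplex_map m n (a : mono m n) : smap (simplex m) (simplex n).
Proof.
exists (fun p (s : simplex m p) => mono_comp a s).
abstract (by move=> p q b s; apply: mono_ext).
Defined.

Definition sprod (X Y : sset) : sset.
Proof.
exists (fun n => X n * Y n)%type (fun m n a x => (act a x.1, act a x.2)).
- abstract (by move=> n [x y]; rewrite !act_id).
- abstract (by move=> m n p b a x; rewrite !act_comp).
Defined.

Definition sfst (X Y : sset) : smap (sprod X Y) X :=
  @SMap (sprod X Y) X (fun _ x => x.1) (fun _ _ _ _ => erefl).

Definition ssnd (X Y : sset) : smap (sprod X Y) Y :=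
  @SMap (sprod X Y) Y (fun _ x => x.2) (fun _ _ _ _ => erefl).

Definition spair (X Y Z : sset) (f : smap Z X) (g : smap Z Y) : smap Z (sprod X Y).
Proof.
exists (fun n z => (f n z, g n z)).
abstract (by move=> m n a z; rewrite !smap_nat).
Defined.

Definition smul (X Y X' Y' : sset) (f : smap X X') (g : smap Y Y') :
  smap (sprod X Y) (sprod X' Y') :=
  spair (f \os sfst X Y) (g \os ssnd X Y).

Section Pullback.
Variables (X Y Z : sset) (f : smap X Z) (g : smap Y Z).

Definition pbsimp n := {p : X n * Y n | f n p.1 = g n p.2}.

Lemma pb_act_subproof m n (a : mono m n) (p : pbsimp n) :
  f m (act a (sval p).1) = g m (act a (sval p).2).
Proof. by rewrite !smap_nat (svalP p). Qed.

Definition pb_act m n (a : mono m n) (p : pbsimp n) : pbsimp m :=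
  exist _ (act a (sval p).1, act a (sval p).2) (pb_act_subproof a p).

Definition pullback : sset.
Proof.
exists pbsimp pb_act.
- abstract (by move=> n [[x y] p]; apply: eq_exist; rewrite /= !act_id).
- abstract (by move=> m n p b a [[x y] q]; apply: eq_exist; rewrite /= !act_comp).
Defined.

Definition pbsnd : smap pullback Y :=
  @SMap pullback Y (fun _ p => (sval p).2) (fun _ _ _ _ => erefl).

End Pullback.

(* [sexp B A] is the internal hom B^A *)
Definition sexp (B A : sset) : sset.
Proof.
exists (fun n => smap (sprod A (simplex n)) B)
  (fun m n a k => k \os smul (sid A) (simplex_map a)).
- abstract (by move=> n k; apply: smap_ext => m [x s] /=;
    congr (k _ (_, _)); apply: mono_ext).
- abstract (by move=> m n p b a k; apply: smap_ext => q [x s] /=;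
    congr (k _ (_, _)); apply: mono_ext).
Defined.

(* Postcomposition k^A : B^A -> C^A, and precomposition B^j : B^A -> B^A' *)
Definition sexp_post (A B C : sset) (k : smap B C) : smap (sexp B A) (sexp C A).
Proof.
exists (fun n (s : sexp B A n) => k \os s).
abstract (by move=> m n a s; apply: smap_ext).
Defined.

Definition sexp_pre (A A' B : sset) (j : smap A' A) : smap (sexp B A) (sexp B A').
Proof.
exists (fun n (s : sexp B A n) => s \os smul j (sid (simplex n))).
abstract (by move=> m n a s; apply: smap_ext).
Defined.

Definition sexp_ev (A B : sset) (x : A 0) : smap (sexp B A) B.
Proof.
exists (fun n (s : sexp B A n) => s n (act (mono_const n ord0) x, mono_id n)).
abstract (by move=> m n a s /=; rewrite -smap_nat /= -act_comp;
  congr (s _ (act _ _, _)); apply: mono_ext).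
Defined.

(* A simplex of Delta^n lies in the k-th horn iff its image misses a vertex
   other than k *)
Definition in_horn n (k : 'I_n.+1) m (s : mono m n) : Prop :=
  exists j, j != k /\ forall i, s i != j.

Lemma in_horn_comp n (k : 'I_n.+1) m p (a : mono m p) (s : mono p n) :
  in_horn k s -> in_horn k (mono_comp s a).
Proof. by case=> j [jk sj]; exists j; split=> // i; apply: sj. Qed.

Definition horn (n : nat) (k : 'I_n.+1) : sset.
Proof.
exists (fun m => {s : mono m n | in_horn k s})
  (fun m p a s => exist _ (mono_comp (sval s) a) (in_horn_comp a (svalP s))).
- abstract (by move=> m [s hs]; apply: eq_exist; apply: mono_ext).
- abstract (by move=> m p q b a s; apply: eq_exist; apply: mono_ext).
Defined.

Definition horn_incl (n : nat) (k : 'I_n.+1) : smap (horn k) (simplex n) :=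
  @SMap (horn k) (simplex n) (fun _ s => sval s) (fun _ _ _ _ => erefl).

Definition quasicategory (X : sset) : Prop :=
  forall (n : nat) (k : 'I_n.+1), 0 < k < n ->
  forall t : smap (horn k) X,
  exists x : smap (simplex n) X, x \os horn_incl k = t.

(* hX is presented by generators the 1-simplices of X and by relations
     s0 x = id   and   d1 t = d0 t o d2 t   for 2-simplices t.
   The theorem [ho_universal] below says that h is left adjoint to the nerve. *)

Section HomotopyCategory.
Variable X : sset.

Inductive word : X 0 -> X 0 -> Type :=
| wedge x y (e : X 1) of src e = x & tgt e = y : word x y
| wid x : word x x
| wcomp x y z of word y z & word x y : word x z.

Inductive wrel : forall x y, word x y -> word x y -> Prop :=
| wrel_refl x y (w : word x y) : wrel w w
| wrel_sym x y (v w : word x y) : wrel v w -> wrel w v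
| wrel_trans x y (u v w : word x y) : wrel u v -> wrel v w -> wrel u w
| wrel_comp x y z (v v' : word y z) (w w' : word x y) :
    wrel v v' -> wrel w w' -> wrel (wcomp v w) (wcomp v' w')
| wrel_comp1f x y (w : word x y) : wrel (wcomp (wid y) w) w
| wrel_compf1 x y (w : word x y) : wrel (wcomp w (wid x)) w
| wrel_compA x y z t (u : word z t) (v : word y z) (w : word x y) :
    wrel (wcomp u (wcomp v w)) (wcomp (wcomp u v) w)
| wrel_degen x (p : src (s0 x) = x) (q : tgt (s0 x) = x) :
    wrel (wedge p q) (wid x)
| wrel_simplex x y z (t : X 2)
    (p2 : src (face (ord_max : 'I_3) t) = x) (q2 : tgt (face (ord_max : 'I_3) t) = y)
    (p0 : src (face (ord0 : 'I_3) t) = y) (q0 : tgt (face (ord0 : 'I_3) t) = z)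
    (p1 : src (face (@Ordinal 3 1 isT) t) = x)
    (q1 : tgt (face (@Ordinal 3 1 isT) t) = z) :
    wrel (wedge p1 q1) (wcomp (wedge p0 q0) (wedge p2 q2)).

Variables x y : X 0.

Definition wrelb : rel {classic word x y} := fun v w => `[< wrel v w >].

Lemma wrelb_equiv : equiv_class_of wrelb.
Proof.
split=> [w|v w|v u w].
- exact/asboolP/wrel_refl.
- by apply/asboolP/asboolP => /wrel_sym.
- by move=> /asboolP h /asboolP k; apply/asboolP; apply: wrel_trans k.
Qed.

Canonical wrelb_equiv_rel := EquivRelPack wrelb_equiv.

Definition ho_hom : Type := {eq_quot wrelb}.

Definition ho_cls (w : word x y) : ho_hom := \pi_({eq_quot wrelb}) w.
Definition ho_repr (f : ho_hom) : word x y := repr (f : {eq_quot wrelb}).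

Lemma ho_reprK f : ho_cls (ho_repr f) = f.
Proof. exact: reprK. Qed.

Lemma ho_clsP (v w : word x y) : ho_cls v = ho_cls w <-> wrel v w.
Proof.
split=> [/eqmodP/asboolP//|h]; exact/eqmodP/asboolP.
Qed.

End HomotopyCategory.

Lemma ho_repr_cls (X : sset) (x y : X 0) (w : word x y) :
  wrel (ho_repr (ho_cls w)) w.
Proof. by apply/ho_clsP; rewrite ho_reprK. Qed.

Definition ho_comp (X : sset) (x y z : X 0) (g : ho_hom y z) (f : ho_hom x y) :
  ho_hom x z :=
  ho_cls (wcomp (ho_repr g) (ho_repr f)).

Lemma ho_compE (X : sset) (x y z : X 0) (v : word y z) (w : word x y) :
  ho_comp (ho_cls v) (ho_cls w) = ho_cls (wcomp v w).
Proof. by apply/ho_clsP; apply: wrel_comp; apply: ho_repr_cls. Qed.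

Definition ho (X : sset) : category.
Proof.
exists (X 0) (@ho_hom X) (fun x => ho_cls (wid x)) (@ho_comp X).
- abstract (by move=> x y f; rewrite -(ho_reprK f) ho_compE;
    apply/ho_clsP/wrel_comp1f).
- abstract (by move=> x y f; rewrite -(ho_reprK f) ho_compE;
    apply/ho_clsP/wrel_compf1).
- abstract (by move=> x y z t h g f;
    rewrite -(ho_reprK f) -(ho_reprK g) -(ho_reprK h) !ho_compE; apply/ho_clsP/wrel_compA).
Defined.

Definition ho_edge (X : sset) (x y : X 0) (e : X 1) (p : src e = x) (q : tgt e = y) :
  @hom (ho X) x y :=
  ho_cls (wedge p q).

Lemma smap_src (X Y : sset) (k : smap X Y) (e : X 1) : src (k 1 e) = k 0 (src e).
Proof. by rewrite /src /face smap_nat. Qed.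

Lemma smap_tgt (X Y : sset) (k : smap X Y) (e : X 1) : tgt (k 1 e) = k 0 (tgt e).
Proof. by rewrite /tgt /face smap_nat. Qed.

Fixpoint word_map (X Y : sset) (k : smap X Y) (x y : X 0) (w : word x y) :
  word (k 0 x) (k 0 y) :=
  match w with
  | wedge _ _ e p q =>
      wedge (etrans (smap_src k e) (congr1 (k 0) p))
            (etrans (smap_tgt k e) (congr1 (k 0) q))
  | wid x => wid (k 0 x)
  | wcomp _ _ _ v w => wcomp (word_map k v) (word_map k w)
  end.

Lemma wedge_eq (X : sset) (x y : X 0) (e e' : X 1) (p : src e = x) (q : tgt e = y)
    (p' : src e' = x) (q' : tgt e' = y) :
  e = e' -> wedge p q = wedge p' q'.
Proof. by move=> h; subst e'; congr wedge; apply: Prop_irrelevance. Qed.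

Lemma wrel_degen_eq (X : sset) (x : X 0) (e : X 1) (p : src e = x) (q : tgt e = x) :
  e = s0 x -> wrel (wedge p q) (wid x).
Proof. by move=> h; subst e; apply: wrel_degen. Qed.

Lemma wrel_simplex_eq (X : sset) (x y z : X 0) (t : X 2) (e2 e0 e1 : X 1)
    (p2 : src e2 = x) (q2 : tgt e2 = y) (p0 : src e0 = y) (q0 : tgt e0 = z)
    (p1 : src e1 = x) (q1 : tgt e1 = z) :
  e2 = face (ord_max : 'I_3) t -> e0 = face (ord0 : 'I_3) t ->
  e1 = face (@Ordinal 3 1 isT) t ->
  wrel (wedge p1 q1) (wcomp (wedge p0 q0) (wedge p2 q2)).
Proof. by move=> h2 h0 h1; subst e2 e0 e1; apply: wrel_simplex. Qed.

Lemma word_map_rel (X Y : sset) (k : smap X Y) (x y : X 0) (v w : word x y) :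
  wrel v w -> wrel (word_map k v) (word_map k w).
Proof.
elim=> {x y v w} /=; try by move=> *; eauto using wrel.
- by move=> x p q; apply: wrel_degen_eq; rewrite /s0 smap_nat.
- move=> x y z t p2 q2 p0 q0 p1 q1.
  by apply: (@wrel_simplex_eq _ _ _ _ (k 2 t)); rewrite /face smap_nat.
Qed.

Definition ho_map (X Y : sset) (k : smap X Y) : functor (ho X) (ho Y).
Proof.
exists (fun x => k 0 x : ho Y)
  (fun x y (f : @hom (ho X) x y) =>
     ho_cls (word_map k (ho_repr f)) : @hom (ho Y) (k 0 x) (k 0 y)).
- abstract (by move=> x; apply/ho_clsP/(word_map_rel k (ho_repr_cls (wid x)))).
- abstract (by move=> x y z g f /=; rewrite ho_compE; apply/ho_clsP;
    apply: (word_map_rel k (ho_repr_cls (wcomp (ho_repr g) (ho_repr f))))).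
Defined.

Lemma ho_mapE (X Y : sset) (k : smap X Y) (x y : X 0) (w : word x y) :
  fmor (ho_map k) (ho_cls w : @hom (ho X) x y) = ho_cls (word_map k w).
Proof. by apply/ho_clsP/word_map_rel/ho_repr_cls. Qed.

Definition ordcat (n : nat) : category :=
  @Category 'I_n.+1 (fun i j => i <= j) (fun i => leqnn i)
    (fun _ _ _ h h' => leq_trans h' h)
    (fun _ _ _ => bool_irrelevance _ _) (fun _ _ _ => bool_irrelevance _ _)
    (fun _ _ _ _ _ _ _ => bool_irrelevance _ _).

Definition ordcat_map m n (a : mono m n) : functor (ordcat m) (ordcat n) :=
  @Functor (ordcat m) (ordcat n) a (fun _ _ h => mono_homo a h)
    (fun _ => bool_irrelevance _ _) (fun _ _ _ _ _ => bool_irrelevance _ _).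

Definition nerve_act (C : category) m n (a : mono m n) (F : functor (ordcat n) C) :=
  functor_comp F (ordcat_map a).

Lemma nerve_act_id (C : category) n (F : functor (ordcat n) C) :
  nerve_act (mono_id n) F = F.
Proof.
apply: (@functor_ext _ _ (nerve_act (mono_id n) F) F (fun i => erefl)) => i j h /=.
by rewrite comp1f compf1; congr fmor; apply: bool_irrelevance.
Qed.

Lemma nerve_act_comp (C : category) m n p (b : mono n p) (a : mono m n)
    (F : functor (ordcat p) C) :
  nerve_act (mono_comp b a) F = nerve_act a (nerve_act b F).
Proof.
apply: (@functor_ext _ _ (nerve_act (mono_comp b a) F) (nerve_act a (nerve_act b F))
  (fun i => erefl)) => i j h /=.
by rewrite comp1f compf1; congr fmor; apply: bool_irrelevance.
Qed.

Definition nerve (C : category) : sset :=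
  SSet (@nerve_act_id C) (@nerve_act_comp C).

Lemma nerve_map_nat (C D : category) (F : functor C D) m n (a : mono m n)
    (s : nerve C n) :
  functor_comp F (nerve_act a s) = nerve_act a (functor_comp F s).
Proof.
apply: (@functor_ext _ _ (functor_comp F (nerve_act a s)) (nerve_act a (functor_comp F s))
  (fun i => erefl)) => i j h /=.
by rewrite comp1f compf1.
Qed.

Definition nerve_map (C D : category) (F : functor C D) : smap (nerve C) (nerve D) :=
  @SMap (nerve C) (nerve D) (fun _ s => functor_comp F s) (@nerve_map_nat C D F).

Section HoUnit.
Variable X : sset.

Definition mono_edge n (i j : 'I_n.+1) (h : i <= j) : mono 1 n.
Proof.
exists (fun k : 'I_2 => if k == ord0 then i else j).
abstract (by case=> [[|[|//]] ?] [[|[|//]] ?]).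
Defined.

Definition mono_tri n (i j k : 'I_n.+1) (h : i <= j) (h' : j <= k) : mono 2 n.
Proof.
exists (fun l : 'I_3 => if val l is l'.+1 then if l' is 0 then j else k else i).
abstract (by case=> [[|[|[|//]]] ?] [[|[|[|//]]] ?] //= _; apply: leq_trans h').
Defined.

Definition vertex n (x : X n) (i : 'I_n.+1) : X 0 := act (mono_const 0 i) x.

Lemma src_edge n (x : X n) (i j : 'I_n.+1) (h : i <= j) :
  src (act (mono_edge h) x) = vertex x i.
Proof.
rewrite /src /face -act_comp /vertex; congr act; apply: mono_ext => k.
by rewrite ord1.
Qed.

Lemma tgt_edge n (x : X n) (i j : 'I_n.+1) (h : i <= j) :
  tgt (act (mono_edge h) x) = vertex x j.
Proof.
rewrite /tgt /face -act_comp /vertex; congr act; apply: mono_ext => k.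
by rewrite ord1.
Qed.

Definition ho_unit_functor n (x : X n) : functor (ordcat n) (ho X).
Proof.
exists (fun i => vertex x i : ho X)
  (fun i j h => ho_edge (src_edge x h) (tgt_edge x h)).
- abstract (by move=> i; apply/ho_clsP/wrel_degen_eq;
    rewrite /s0 /vertex -act_comp; congr act; apply: mono_ext => k /=; case: ifP).
- abstract (by move=> i j k h' h; rewrite /= ho_compE;
    apply/ho_clsP/(@wrel_simplex_eq _ _ _ _ (act (mono_tri h h') x));
    rewrite /face -act_comp; congr act; apply: mono_ext; case=> [[|[|//]] ?]).
Defined.

Lemma ho_edge_eqhom (x y x' y' : ho X) (e e' : X 1) (p : src e = x) (q : tgt e = y)
    (p' : src e' = x') (q' : tgt e' = y') (hx : x = x') (hy : y = y') :
  e = e' -> eqhom hy \oc ho_edge p q = ho_edge p' q' \oc eqhom hx.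
Proof.
move=> h; subst; rewrite !eqhom_id comp1f compf1; congr ho_cls.
Qed.

Lemma vertex_act m n (a : mono m n) (x : X n) (i : 'I_m.+1) :
  vertex (act a x) i = vertex x (a i).
Proof. by rewrite /vertex -act_comp; congr act; apply: mono_ext. Qed.

Lemma ho_unit_nat m n (a : mono m n) (x : X n) :
  ho_unit_functor (act a x) = nerve_act a (ho_unit_functor x).
Proof.
apply: (@functor_ext _ _ (ho_unit_functor (act a x)) (nerve_act a (ho_unit_functor x))
  (vertex_act a x)) => i j h; apply: ho_edge_eqhom.
by rewrite -act_comp; congr act; apply: mono_ext => k /=; case: ifP.
Qed.

Definition ho_unit : smap X (nerve (ho X)) :=
  @SMap X (nerve (ho X)) (@ho_unit_functor) ho_unit_nat.

End HoUnit.

Section HoUniversal.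
Variables (X : sset) (C : category) (G : smap X (nerve C)).

Definition hu_ob (x : X 0) : C := fob (G 0 x) ord0.

Lemma hu_ob_vertex n (x : X n) (i : 'I_n.+1) : hu_ob (vertex x i) = fob (G n x) i.
Proof. by rewrite /hu_ob /vertex smap_nat. Qed.

Lemma hu_ob_src (e : X 1) x : src e = x -> hu_ob x = fob (G 1 e) ord0.
Proof.
move=> <-; rewrite /hu_ob /src /face smap_nat /=.
by congr fob; apply: val_inj.
Qed.

Lemma hu_ob_tgt (e : X 1) x : tgt e = x -> fob (G 1 e) ord_max = hu_ob x.
Proof.
move=> <-; rewrite /hu_ob /tgt /face smap_nat /=.
by congr fob; apply: val_inj.
Qed.

Definition le01 : @hom (ordcat 1) ord0 ord_max := isT.

Fixpoint hu_word (x y : X 0) (w : word x y) : hom (hu_ob x) (hu_ob y) :=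
  match w with
  | wedge _ _ e p q =>
      eqhom (hu_ob_tgt q) \oc fmor (G 1 e) le01 \oc eqhom (hu_ob_src p)
  | wid x => idc (hu_ob x)
  | wcomp _ _ _ v w => hu_word v \oc hu_word w
  end.

Lemma fmor_eq n (F F' : functor (ordcat n) C) (i j : ordcat n) (h : hom i j) (x y : C)
    (ex : x = F i) (ex' : x = F' i) (ey : F j = y) (ey' : F' j = y) :
  F = F' ->
  eqhom ey \oc fmor F h \oc eqhom ex = eqhom ey' \oc fmor F' h \oc eqhom ex'.
Proof.
move=> E; subst F'.
by rewrite (Prop_irrelevance ex ex') (Prop_irrelevance ey ey').
Qed.

Lemma hu_wordE n (z : X n) (a : mono 1 n) (i j : 'I_n.+1) (h : i <= j) e x y
    (p : src e = x) (q : tgt e = y)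
    (ex : hu_ob x = fob (G n z) i) (ey : fob (G n z) j = hu_ob y) :
  e = act a z -> i = a ord0 -> j = a ord_max ->
  hu_word (wedge p q) =
  eqhom ey \oc @fmor _ _ (G n z) i j h \oc eqhom ex.
Proof.
move=> E Ei Ej; subst i j e.
rewrite /= (@fmor_eq _ _ (nerve_act a (G n z)) _ _ _ _ _ _ ex _ ey) ?smap_nat //.
by rewrite (bool_irrelevance h (mono_homo a le01)).
Qed.

Lemma eqhom_loop (D : category) (x y : D) (e : x = y) (e' : y = x) :
  eqhom e' \oc eqhom e = idc x.
Proof. by rewrite eqhom_comp eqhom_id. Qed.

Lemma hu_ob_act n (z : X n) (a : mono 0 n) : hu_ob (act a z) = fob (G n z) (a ord0).
Proof. by rewrite /hu_ob smap_nat. Qed.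

Lemma hu_word_simplex x y z (t : X 2)
    (p2 : src (face (ord_max : 'I_3) t) = x) (q2 : tgt (face (ord_max : 'I_3) t) = y)
    (p0 : src (face (ord0 : 'I_3) t) = y) (q0 : tgt (face (ord0 : 'I_3) t) = z)
    (p1 : src (face (@Ordinal 3 1 isT) t) = x)
    (q1 : tgt (face (@Ordinal 3 1 isT) t) = z) :
  hu_word (wedge p1 q1) = hu_word (wedge p0 q0) \oc hu_word (wedge p2 q2).
Proof.
pose i1 := @Ordinal 3 1 isT.
have ex : hu_ob x = fob (G 2 t) ord0.
  by rewrite -p2 /src /face -act_comp hu_ob_act; congr fob; apply: val_inj.
have ey : hu_ob y = fob (G 2 t) i1.
  by rewrite -p0 /src /face -act_comp hu_ob_act; congr fob; apply: val_inj.
have ez : hu_ob z = fob (G 2 t) ord_max.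
  by rewrite -q0 /tgt /face -act_comp hu_ob_act; congr fob; apply: val_inj.
have h01 : (ord0 : 'I_3) <= i1 by [].
have h12 : i1 <= (ord_max : 'I_3) by [].
have h02 : (ord0 : 'I_3) <= (ord_max : 'I_3) by [].
rewrite (hu_wordE (a := (coface ord_max)) h01 p2 q2 ex (esym ey)) //; try by apply: val_inj.
rewrite (hu_wordE (a := (coface ord0)) h12 p0 q0 ey (esym ez)) //; try by apply: val_inj.
rewrite (hu_wordE (a := (coface i1)) h02 p1 q1 ex (esym ez)) //; try by apply: val_inj.
rewrite (bool_irrelevance h02 (leq_trans h01 h12)).
rewrite (@fmorM _ _ (G 2 t) ord0 i1 ord_max h12 h01) -!compA.
by rewrite [in RHS](compA (eqhom ey)) eqhom_loop comp1f.
Qed.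

Lemma hu_word_rel x y (v w : word x y) : wrel v w -> hu_word v = hu_word w.
Proof.
elim=> {x y v w} //.
- by move=> x y u v w _ -> _ ->.
- by move=> x y z v v' w w' _ /= -> _ ->.
- by move=> x y w; rewrite /= comp1f.
- by move=> x y w; rewrite /= compf1.
- by move=> x y z t u v w; rewrite /= compA.
- move=> x p q.
  rewrite (@hu_wordE 0 x (mono_const 1 ord0) ord0 ord0 (leqnn 0) _ _ _ _ _ erefl erefl) //.
  by rewrite -[@fmor _ _ _ _ _ _]/(fmor (G 0 x) (idc _)) fmor1 comp1f compf1.
- by move=> *; apply: hu_word_simplex.
Qed.

Definition hu_functor : functor (ho X) C.
Proof.
exists (hu_ob : ho X -> C)
  (fun x y (f : @hom (ho X) x y) => hu_word (ho_repr f)).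
- abstract (by move=> x; rewrite (hu_word_rel (ho_repr_cls (wid x)))).
- abstract (by move=> x y z g f;
    rewrite (hu_word_rel (ho_repr_cls (wcomp (ho_repr g) (ho_repr f))))).
Defined.

Lemma hu_functorE x y (w : word x y) :
  fmor hu_functor (ho_cls w : @hom (ho X) x y) = hu_word w.
Proof. exact/hu_word_rel/ho_repr_cls. Qed.

Lemma hu_functor_unit : nerve_map hu_functor \os ho_unit X = G.
Proof.
apply: smap_ext => n x /=.
apply: (@functor_ext _ _ (functor_comp hu_functor (ho_unit_functor x)) (G n x)
  (hu_ob_vertex x)) => i j h.
have -> : fmor (functor_comp hu_functor (ho_unit_functor x)) h =
    hu_word (wedge (src_edge x h) (tgt_edge x h)) by exact: hu_functorE.
rewrite (@hu_wordE _ x (mono_edge h) i j h _ _ _ _ _ (hu_ob_vertex x i)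
  (esym (hu_ob_vertex x j))) //.
by rewrite !compA eqhom_loop comp1f.
Qed.

Lemma fmor_eqhom (D E : category) (F : functor D E) (x y : D) (e : x = y) :
  fmor F (eqhom e) = eqhom (congr1 F e).
Proof. by case: y / e; rewrite fmor1. Qed.

Lemma hu_functor_unique (F : functor (ho X) C) :
  nerve_map F \os ho_unit X = G -> F = hu_functor.
Proof.
move=> FG.
have Fn n (x : X n) : functor_comp F (ho_unit_functor x) = G n x.
  by rewrite -FG.
have e x : F x = hu_functor x.
  rewrite /= /hu_ob -Fn /= /vertex; congr (fob F).
  by rewrite -[LHS]act_id; congr act; apply: mono_ext => i; rewrite ord1.
apply: (functor_ext (e := e)) => x y f; rewrite -(ho_reprK f) hu_functorE.
elim: (ho_repr f) => {x y f} [x y u p q|x|x y z v IHv w IHw].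
- subst x y.
  have hx : vertex u ord0 = src u.
    rewrite /src /face /vertex; congr act; apply: mono_ext => i; apply: val_inj.
    by rewrite ord1.
  have hy : vertex u ord_max = tgt u.
    rewrite /tgt /face /vertex; congr act; apply: mono_ext => i; apply: val_inj.
    by rewrite ord1.
  have hu : act (mono_edge le01) u = u.
    rewrite -[RHS]act_id; congr act; apply: mono_ext.
    by case=> [[|[|//]] ?]; apply: val_inj.
  have E : ho_edge (erefl (src u)) (erefl (tgt u)) =
      eqhom (hy : vertex u ord_max = _ :> ho X) \oc
      ho_edge (src_edge u le01) (tgt_edge u le01) \oc
      eqhom (esym hx : _ = vertex u ord0 :> ho X).
    rewrite (ho_edge_eqhom (src_edge u le01) (tgt_edge u le01) erefl erefl hx hy hu).
    by rewrite -compA eqhom_comp eqhom_id compf1.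
  rewrite -[ho_cls _]/(ho_edge (erefl (src u)) (erefl (tgt u))) E !fmorM !fmor_eqhom.
  have -> : hu_word (wedge (erefl (src u)) (erefl (tgt u))) =
    eqhom (hu_ob_tgt erefl) \oc fmor (G 1 u) le01 \oc eqhom (hu_ob_src erefl) by [].
  rewrite !compA eqhom_comp -[RHS]compA eqhom_comp.
  exact: (@fmor_eq _ (functor_comp F (ho_unit_functor u)) (G 1 u) _ _ le01).
- by rewrite -[ho_cls _]/(@idc (ho X) x) fmor1 comp1f compf1.
- rewrite -ho_compE -[ho_comp _ _]/(@comp (ho X) _ _ _ (ho_cls v) (ho_cls w)).
  by rewrite fmorM compA IHv -compA IHw compA.
Qed.

End HoUniversal.

(* Every simplicial map X -> N(C) factors uniquely through the unit X -> N(hX) *)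
Theorem ho_universal (X : sset) (C : category) (G : smap X (nerve C)) :
  exists! F : functor (ho X) C, nerve_map F \os ho_unit X = G.
Proof.
exists (hu_functor G); split; first exact: hu_functor_unit.
by move=> F /hu_functor_unique.
Qed.

(* A functor f : A -> B, as a vertex of B^A *)
Definition name (A B : sset) (f : smap A B) : sexp B A 0 := f \os sfst A (simplex 0).

(* hom'(A, B) = h(B^A) *)
Definition hom' (A B : sset) : category := ho (sexp B A).

Definition cell (A B : sset) (f g : smap A B) : Type :=
  @hom (hom' A B) (name f) (name g).

(* The identity 2-cell along an equality of functors. Composition of functors
   is strictly associative and unital, but only up to propositional equality, so
   these cells mark the places where the 2-category is strict. *)
Definition eqcell (A B : sset) (f g : smap A B) (e : f = g) : cell f g :=
  @eqhom (hom' A B) _ _ (congr1 (@name A B) e).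

Lemma name_post (A B C : sset) (k : smap B C) (f : smap A B) :
  sexp_post A k 0 (name f) = name (k \os f).
Proof. exact: smap_ext. Qed.

Lemma name_pre (A A' B : sset) (j : smap A' A) (f : smap A B) :
  sexp_pre B j 0 (name f) = name (f \os j).
Proof. exact: smap_ext. Qed.

(* Whiskering: the functors h(k^A) and h(B^j) *)
Definition whisker_post (A B C : sset) (k : smap B C) (f g : smap A B)
    (a : cell f g) : cell (k \os f) (k \os g) :=
  eqhom (name_post k g : _ = _ :> hom' A C) \oc fmor (ho_map (sexp_post A k)) a \oc
  eqhom (esym (name_post k f) : _ = _ :> hom' A C).

Definition whisker_pre (A A' B : sset) (j : smap A' A) (f g : smap A B)
    (a : cell f g) : cell (f \os j) (g \os j) :=
  eqhom (name_pre j g : _ = _ :> hom' A' B) \oc fmor (ho_map (sexp_pre B j)) a \oc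
  eqhom (esym (name_pre j f) : _ = _ :> hom' A' B).

(* (eps f) . (f eta) = id_f  and  (u eps) . (eta u) = id_u *)
Definition left_adjoint (A B : sset) (f : smap B A) (u : smap A B) : Prop :=
  exists (eta : cell (sid B) (u \os f)) (eps : cell (f \os u) (sid A)),
    eqcell (scomp1f f) \oc whisker_pre f eps \oc eqcell (scompA f u f) \oc
      whisker_post f eta \oc eqcell (esym (scompf1 f)) = idc (name f : hom' B A)
    /\
    eqcell (scompf1 u) \oc whisker_post u eps \oc eqcell (esym (scompA u f u)) \oc
      whisker_pre u eta \oc eqcell (esym (scomp1f u)) = idc (name u : hom' A B).

Definition dom (A : sset) : smap (sexp A (simplex 1)) A :=
  sexp_ev A (mono_const 0 ord0 : simplex 1 0).

Definition cod (A : sset) : smap (sexp A (simplex 1)) A :=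
  sexp_ev A (mono_const 0 ord_max : simplex 1 0).

(* f | A: pairs (t, (a, b)) with t : f b -> a in A^Delta^1 *)
Definition comma_left (A B : sset) (f : smap B A) : sset :=
  pullback (spair (cod A) (dom A)) (smul (sid A) f).

Definition comma_left_proj (A B : sset) (f : smap B A) :
    smap (comma_left f) (sprod A B) :=
  pbsnd (spair (cod A) (dom A)) (smul (sid A) f).

(* B | u: pairs (t, (a, b)) with t : b -> u a in B^Delta^1 *)
Definition comma_right (A B : sset) (u : smap A B) : sset :=
  pullback (spair (cod B) (dom B)) (smul u (sid B)).

Definition comma_right_proj (A B : sset) (u : smap A B) :
    smap (comma_right u) (sprod A B) :=
  pbsnd (spair (cod B) (dom B)) (smul u (sid B)).

Definition edge_iso (X : sset) (e : X 1) : Prop :=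
  is_iso (ho_edge (erefl (src e)) (erefl (tgt e))).

Definition degenerate (X : sset) (e : X 1) : Prop := exists x : X 0, e = s0 x.

(* [f] and [g] are isomorphic in E^E, by a 1-simplex whose composite with [p]
   is degenerate *)
Definition fibred_iso (E Q : sset) (p : smap E Q) (f g : smap E E) : Prop :=
  exists e : sexp E E 1,
    [/\ src e = name f, tgt e = name g, edge_iso e & degenerate (sexp_post E p 1 e)].

Definition fibred_equivalence (E F Q : sset) (p : smap E Q) (q : smap F Q)
    (w : smap E F) : Prop :=
  q \os w = p /\
  exists w' : smap F E,
    [/\ p \os w' = q, fibred_iso p (w' \os w) (sid E) & fibred_iso q (sid F) (w \os w')].

(* Main.v *)
(* A functor X -> f | A over (a, b) is an arrow f b -> a of A^X, so maps w and w'
   over A x B transpose such arrows to arrows b -> u a and back.  Take eta = w(id_f)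
   and eps = w'(id_u).  The connection square (min on Delta^1 x Delta^1) is an edge
   of (f | A)^X from id_{f b} to any alpha : f b -> a, and w sends it to a square
   showing that w(alpha) is u alpha o eta b in h(B^X); dually (with max) w'(beta)
   is eps a o f beta.  Hence the triangle composites are the classes of w(w'(id_u))
   and w'(w(id_f)).  Since the isomorphisms w w' = id and w' w = id lie over
   degenerate edges of A x B, they give squares with two degenerate sides, which
   identify these classes with those of id_u and id_f. *)

From mathcomp Require Import all_boot boolp.
Require Import Defs.

Set Implicit Arguments.
Unset Strict Implicit.
Unset Printing Implicit Defensive.

Local Notation D1 := (simplex 1).

(** * Endpoints of homotopies [sprod X D1 -> C], the 1-simplices of the internal hom *)

Definition vert (X : sset) (i : 'I_2) : smap X (sprod X D1).
Proof.
exists (fun n x => (x, mono_const n i : D1 n)).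
abstract (by move=> m n a x; congr pair; apply: mono_ext).
Defined.

Lemma vert_nat (X Y : sset) (j : smap X Y) (i : 'I_2) :
  smul j (sid D1) \os vert X i = vert Y i \os j.
Proof. exact: smap_ext. Qed.

Lemma src_sexp (X C : sset) (t : smap (sprod X D1) C) :
  src (t : sexp C X 1) = name (t \os vert X ord0).
Proof.
apply: smap_ext => n [x s] /=; congr (t _ (_, _)); apply: mono_ext => i /=.
by apply: val_inj; rewrite /= ord1.
Qed.

Lemma tgt_sexp (X C : sset) (t : smap (sprod X D1) C) :
  tgt (t : sexp C X 1) = name (t \os vert X ord_max).
Proof.
apply: smap_ext => n [x s] /=; congr (t _ (_, _)); apply: mono_ext => i /=.
by apply: val_inj; rewrite /= ord1.
Qed.

(** The first factor of X x Delta^0 recovers the functor. This turns the endpoint conditions of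
    [fibred_iso], equalities of vertices, into equalities of simplicial maps. *)
Lemma name_inj (X C : sset) : injective (@name X C).
Proof.
move=> f g /(congr1 (fun k : smap (sprod X (simplex 0)) C => k : forall n, _)) h.
apply: smap_ext => n x.
exact: (congr1 (fun k : forall n, sprod X (simplex 0) n -> C n =>
  k n (x, mono_const n ord0)) h).
Qed.

Lemma s0_sexp (X C : sset) (f : smap X C) :
  s0 (name f) = f \os sfst X D1 :> smap (sprod X D1) C.
Proof. exact: smap_ext. Qed.

(** * 2-cells represented by homotopies, and commuting squares of them *)

Section EdgeCells.
Variables X C : sset.
Implicit Types (f g h : smap X C) (t : smap (sprod X D1) C).

(** The ends [f] and [g] are tied to [t] by proofs, so that one homotopy can represent cells between
    functors that are only propositionally equal; coherence cells [eqcell] are then absorbed into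
    these proofs. *)
Definition edge_cell t f g (p : t \os vert X ord0 = f) (q : t \os vert X ord_max = g) :
  cell f g :=
  @ho_edge (sexp C X) (name f) (name g) t
    (etrans (src_sexp t) (congr1 (@name X C) p))
    (etrans (tgt_sexp t) (congr1 (@name X C) q)).

Lemma edge_cell_eq t t' f g p q p' q' :
  t = t' -> @edge_cell t f g p q = @edge_cell t' f g p' q'.
Proof.
by move=> e; subst t'; rewrite (Prop_irrelevance p p') (Prop_irrelevance q q').
Qed.

Lemma edge_cell_id t f p q : t = f \os sfst X D1 -> @edge_cell t f f p q = idc _.
Proof. by move=> e; apply/ho_clsP/wrel_degen_eq; rewrite s0_sexp. Qed.

Lemma eqcell_edge t f g g' p q (e : g = g') :
  eqcell e \oc @edge_cell t f g p q = edge_cell p (etrans q e).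
Proof. by case: g' / e; rewrite (Prop_irrelevance (etrans _ _) q); apply: comp1f. Qed.

Lemma edge_eqcell t f f' g p q (e : f' = f) :
  @edge_cell t f g p q \oc eqcell e = edge_cell (etrans p (esym e)) q.
Proof.
by case: f / e p => p; rewrite (Prop_irrelevance (etrans _ _) p); apply: compf1.
Qed.

(** The pair [(a, b)] is an m-simplex of Delta^1 x Delta^1; restricting [S] along it makes the
    triangulation of the square available inside C^X. *)
Definition square_simplex (S : smap (sprod (sprod X D1) D1) C) m (a b : mono m 1) :
  sexp C X m :=
  S \os spair (smul (sid X) (simplex_map a)) (simplex_map b \os ssnd X (simplex m)).

Lemma face_square_simplex S m (a b : mono m.+1 1) i :
  face i (square_simplex S a b) =
  square_simplex S (mono_comp a (coface i)) (mono_comp b (coface i)).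
Proof.
by apply: smap_ext => n [x s] /=; congr (S _ ((_, _), _)); apply: mono_ext.
Qed.

(** The diagonal cuts the square into two 2-simplices, and each identifies one of the composites
    with the class of the diagonal. In [fij], [i] is the coordinate in the inner copy of [D1] and
    [j] the one in the outer copy. *)
Lemma square_commutes (S : smap (sprod (sprod X D1) D1) C) f00 f01 f10 f11
    t0 t1 l0 l1 p0 q0 p1 q1 r0 s0 r1 s1 :
  t0 = S \os vert _ ord0 -> t1 = S \os vert _ ord_max ->
  l0 = S \os smul (vert X ord0) (sid D1) -> l1 = S \os smul (vert X ord_max) (sid D1) ->
  @edge_cell t1 f01 f11 p1 q1 \oc @edge_cell l0 f00 f01 r0 s0 =
  @edge_cell l1 f10 f11 r1 s1 \oc @edge_cell t0 f00 f10 p0 q0.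
Proof.
move=> et0 et1 el0 el1.
pose d0 := square_simplex S (mono_id 1) (mono_id 1).
pose z := ord0 : 'I_2; pose o := ord_max : 'I_2.
(* With vertices 0,0,1 and 0,1,1, the pairs [(zzo, zoo)] and [(zoo, zzo)] are the two nondegenerate
   2-simplices of Delta^1 x Delta^1. *)
pose zzo := @mono_tri 1 z z o isT isT; pose zoo := @mono_tri 1 z o o isT isT.
have face_eq t i a b a' b' :
    t = square_simplex S a' b' -> mono_comp a (coface i) = a' ->
    mono_comp b (coface i) = b' -> t = face i (square_simplex S a b).
  by move=> -> <- <-; rewrite face_square_simplex.
have E0 : t0 = square_simplex S (mono_id 1) (mono_const 1 z).
  rewrite et0; apply: smap_ext => n [x s] /=; congr (S _ ((_, _), _)); exact: mono_ext.
have E1 : t1 = square_simplex S (mono_id 1) (mono_const 1 o).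
  rewrite et1; apply: smap_ext => n [x s] /=; congr (S _ ((_, _), _)); exact: mono_ext.
have F0 : l0 = square_simplex S (mono_const 1 z) (mono_id 1).
  rewrite el0; apply: smap_ext => n [x s] /=; congr (S _ ((_, _), _)); exact: mono_ext.
have F1 : l1 = square_simplex S (mono_const 1 o) (mono_id 1).
  rewrite el1; apply: smap_ext => n [x s] /=; congr (S _ ((_, _), _)); exact: mono_ext.
have pd : src d0 = name f00.
  rewrite src_sexp -p0; congr name; rewrite E0.
  by apply: smap_ext => n x /=; congr (S _ ((_, _), _)); apply: mono_ext.
have qd : tgt d0 = name f11.
  rewrite tgt_sexp -q1; congr name; rewrite E1.
  by apply: smap_ext => n x /=; congr (S _ ((_, _), _)); apply: mono_ext.
transitivity (ho_edge pd qd); first symmetry.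
all: rewrite [RHS]ho_compE; apply/ho_clsP.
- apply: (@wrel_simplex_eq _ _ _ _ (square_simplex S zzo zoo)).
  + by apply: face_eq F0 _ _; apply: mono_ext; case=> [[|[|//]] ?]; apply: val_inj.
  + by apply: face_eq E1 _ _; apply: mono_ext; case=> [[|[|//]] ?]; apply: val_inj.
  + by apply: face_eq (erefl d0) _ _; apply: mono_ext; case=> [[|[|//]] ?]; apply: val_inj.
- apply: (@wrel_simplex_eq _ _ _ _ (square_simplex S zoo zzo)).
  + by apply: face_eq E0 _ _; apply: mono_ext; case=> [[|[|//]] ?]; apply: val_inj.
  + by apply: face_eq F1 _ _; apply: mono_ext; case=> [[|[|//]] ?]; apply: val_inj.
  + by apply: face_eq (erefl d0) _ _; apply: mono_ext; case=> [[|[|//]] ?]; apply: val_inj.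
Qed.

End EdgeCells.

(** * Whiskering of cells represented by homotopies *)

Lemma eqhom_ho_edge (Z : sset) (x y x' y' : ho Z) (e e' : Z 1) (p : src e = x)
    (q : tgt e = y) (p' : src e' = x') (q' : tgt e' = y') (hx : x' = x) (hy : y = y') :
  e = e' -> eqhom hy \oc ho_edge p q \oc eqhom hx = ho_edge p' q'.
Proof.
move=> ee; subst e'; move: p' q'; case: y' / hy; case: x / hx p => p p' q'.
rewrite (Prop_irrelevance p' p) (Prop_irrelevance q' q).
exact: etrans (compf1 _) (comp1f _).
Qed.

Lemma whisker_post_edge (X C D : sset) (k : smap C D) t (f g : smap X C) p q :
  whisker_post k (@edge_cell X C t f g p q) =
  edge_cell (etrans (esym (scompA k t _)) (congr1 (scomp k) p))
            (etrans (esym (scompA k t _)) (congr1 (scomp k) q)).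
Proof.
rewrite /whisker_post [X in _ \oc X \oc _]ho_mapE.
exact: eqhom_ho_edge.
Qed.

Lemma pre_vert (X Y C : sset) (j : smap Y X) (t : smap (sprod X D1) C) i :
  t \os smul j (sid D1) \os vert Y i = t \os vert X i \os j.
Proof. exact: smap_ext. Qed.

Lemma whisker_pre_edge (X Y C : sset) (j : smap Y X) t (f g : smap X C) p q :
  whisker_pre j (@edge_cell X C t f g p q) =
  edge_cell (etrans (pre_vert j t ord0) (congr1 (fun k => k \os j) p))
            (etrans (pre_vert j t ord_max) (congr1 (fun k => k \os j) q)).
Proof.
rewrite /whisker_pre [X in _ \oc X \oc _]ho_mapE.
exact: eqhom_ho_edge.
Qed.

(** * The exponential adjunction *)

Definition curry (X Y C : sset) (t : smap (sprod X Y) C) : smap X (sexp C Y).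
Proof.
exists (fun n x => @SMap (sprod Y (simplex n)) C
  (fun m y => t m (act (y.2 : mono m n) x, y.1))
  (fun m p a y => etrans (congr1 (fun z => t m (z, act a y.1)) (act_comp _ _ _))
     (smap_nat t a (act (y.2 : mono p n) x, y.1)))).
abstract (by move=> m n a x; apply: smap_ext => p y /=; rewrite -act_comp).
Defined.

Definition uncurry (X Y C : sset) (k : smap X (sexp C Y)) : smap (sprod X Y) C.
Proof.
exists (fun n x => k n x.1 n (x.2, mono_id n)).
abstract (by move=> m n a [x y] /=; rewrite (smap_nat k) -(smap_nat (k n x)) /=;
  congr (k _ _ _ (_, _));  apply: mono_ext).
Defined.

Lemma curryK (X Y C : sset) (t : smap (sprod X Y) C) : uncurry (curry t) = t.
Proof. by apply: smap_ext => n [x y] /=; rewrite act_id. Qed.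

Lemma uncurryK (X Y C : sset) (k : smap X (sexp C Y)) : curry (uncurry k) = k.
Proof.
apply: smap_ext => n x; apply: smap_ext => m [y s] /=.
by rewrite smap_nat /=; congr (k _ _ _ (_, _)); apply: mono_ext.
Qed.

(** * The universal property of comma objects *)

Section Comma.
Variables (A B C : sset) (g : smap A C) (h : smap B C).

(* [comma_left f] is [comma (sid A) f] and [comma_right u] is [comma u (sid B)]. *)
Definition comma : sset := pullback (spair (cod C) (dom C)) (smul g h).

Definition comma_proj : smap comma (sprod A B) :=
  pbsnd (spair (cod C) (dom C)) (smul g h).

Definition comma_arrow : smap comma (sexp C D1) :=
  @SMap comma (sexp C D1) (fun _ x => (sval x).1) (fun _ _ _ _ => erefl).

(** The arrow from h b to g a in C^X carried by a generalized element [k] over (a, b), in the form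
    of a homotopy. *)
Definition comma_edge X (k : smap X comma) : smap (sprod X D1) C :=
  uncurry (comma_arrow \os k).

Lemma comma_edge_comp X Y (k : smap X comma) (j : smap Y X) :
  comma_edge (k \os j) = comma_edge k \os smul j (sid D1).
Proof. exact: smap_ext. Qed.

Lemma comma_edge_tgt X (k : smap X comma) a b :
  comma_proj \os k = spair a b -> comma_edge k \os vert X ord_max = g \os a.
Proof.
move=> e; have -> : a = sfst A B \os comma_proj \os k by rewrite -scompA e; apply: smap_ext.
apply: smap_ext => n x /=; apply: etrans (congr1 fst (svalP (k n x))) => /=.
by congr (smap_fun (sval (k n x)).1 (_ : sprod D1 (simplex n) n)); congr pair; apply: mono_ext.
Qed.

Lemma comma_edge_src X (k : smap X comma) a b :
  comma_proj \os k = spair a b -> comma_edge k \os vert X ord0 = h \os b.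
Proof.
move=> e; have -> : b = ssnd A B \os comma_proj \os k by rewrite -scompA e; apply: smap_ext.
apply: smap_ext => n x /=; apply: etrans (congr1 snd (svalP (k n x))) => /=.
by congr (smap_fun (sval (k n x)).1 (_ : sprod D1 (simplex n) n)); congr pair; apply: mono_ext.
Qed.

Lemma comma_ext X (k k' : smap X comma) :
  comma_edge k = comma_edge k' -> comma_proj \os k = comma_proj \os k' -> k = k'.
Proof.
move=> /(congr1 (@curry _ _ _)); rewrite !uncurryK => e1 e2.
apply: smap_ext => n x.
apply: (eq_sig_hprop (fun _ => @Prop_irrelevance _) (k n x) (k' n x)).
move: (congr1 (fun z : smap X (sexp C D1) => z n x) e1) => /=.
move: (congr1 (fun z : smap X (sprod A B) => z n x) e2) => /=.
by case: (k n x) => [[? ?] ?]; case: (k' n x) => [[? ?] ?] /= -> ->.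
Qed.

Section CommaPair.
Variables (X : sset) (t : smap (sprod X D1) C) (a : smap X A) (b : smap X B).
Hypotheses (ta : t \os vert X ord_max = g \os a) (tb : t \os vert X ord0 = h \os b).

Lemma comma_pair_subproof n (x : X n) :
  spair (cod C) (dom C) n (curry t n x) = smul g h n (a n x, b n x).
Proof.
move: (congr1 (fun z : smap X C => z n x) ta) (congr1 (fun z : smap X C => z n x) tb).
rewrite /= => <- <-; congr pair; rewrite act_id; congr (t _ (_, _)); exact: mono_ext.
Qed.

(** Together with [comma_ext] this is the strict universal property: elements over (a, b) correspond
    to arrows from h b to g a. *)
Definition comma_pair : smap X comma.
Proof.
exists (fun n x => exist _ (curry t n x, (a n x, b n x)) (comma_pair_subproof x)).
abstract (by move=> m n c x; apply: eq_exist; rewrite !smap_nat).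
Defined.

Lemma comma_edge_pair : comma_edge comma_pair = t.
Proof. by apply: smap_ext => n [x y] /=; rewrite act_id. Qed.

Lemma comma_proj_pair : comma_proj \os comma_pair = spair a b.
Proof. exact: smap_ext. Qed.

End CommaPair.

End Comma.

(** * Homotopies of elements of a comma object, read as squares *)

Section CommaSquares.
Variables (A B C : sset) (g : smap A C) (h : smap B C).
Variables (X : sset) (K : smap (sprod X D1) (comma g h)).

(** In the square [comma_edge K] the outer [D1] is the direction of the arrows. The side at the
    sources is constant because the B-component of [K] is, so it contributes an identity to
    [square_commutes]. *)
Lemma comma_square_tgt (a : smap (sprod X D1) A) (b : smap X B) f01 f11 p1 q1 r0 s0 r1 s1 :
  comma_proj g h \os K = spair a (b \os sfst X D1) ->
  @edge_cell X C (g \os a) f01 f11 p1 q1 \oc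
    @edge_cell X C (comma_edge (K \os vert X ord0)) (h \os b) f01 r0 s0 =
  @edge_cell X C (comma_edge (K \os vert X ord_max)) (h \os b) f11 r1 s1.
Proof.
move=> e.
have p : h \os b \os sfst X D1 \os vert X ord0 = h \os b by exact: smap_ext.
have q : h \os b \os sfst X D1 \os vert X ord_max = h \os b by exact: smap_ext.
rewrite (square_commutes (S := comma_edge K) p q p1 q1 r0 s0 r1 s1).
- by rewrite edge_cell_id //; apply: compf1.
- by rewrite (comma_edge_src e) scompA.
- by rewrite (comma_edge_tgt e).
- exact: comma_edge_comp.
- exact: comma_edge_comp.
Qed.

Lemma comma_square_src (a : smap X A) (b : smap (sprod X D1) B) f00 f10 p0 q0 r0 s0 r1 s1 :
  comma_proj g h \os K = spair (a \os sfst X D1) b ->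
  @edge_cell X C (comma_edge (K \os vert X ord_max)) f10 (g \os a) r1 s1 \oc
    @edge_cell X C (h \os b) f00 f10 p0 q0 =
  @edge_cell X C (comma_edge (K \os vert X ord0)) f00 (g \os a) r0 s0.
Proof.
move=> e.
have p : g \os a \os sfst X D1 \os vert X ord0 = g \os a by exact: smap_ext.
have q : g \os a \os sfst X D1 \os vert X ord_max = g \os a by exact: smap_ext.
rewrite -(square_commutes (S := comma_edge K) p0 q0 p q r0 s0 r1 s1).
- by rewrite edge_cell_id //; apply: comp1f.
- by rewrite (comma_edge_src e).
- by rewrite (comma_edge_tgt e) scompA.
- exact: comma_edge_comp.
- exact: comma_edge_comp.
Qed.

(** When the A-component is constant too, the remaining side is also an identity: a homotopy over a
    constant one does not change the class of the arrow. *)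
Lemma comma_square_const (a : smap X A) (b : smap X B) r0 s0 r1 s1 :
  comma_proj g h \os K = spair (a \os sfst X D1) (b \os sfst X D1) ->
  @edge_cell X C (comma_edge (K \os vert X ord0)) (h \os b) (g \os a) r0 s0 =
  @edge_cell X C (comma_edge (K \os vert X ord_max)) (h \os b) (g \os a) r1 s1.
Proof.
move=> e.
have p : g \os (a \os sfst X D1) \os vert X ord0 = g \os a by exact: smap_ext.
have q : g \os (a \os sfst X D1) \os vert X ord_max = g \os a by exact: smap_ext.
rewrite -(comma_square_tgt p q r0 s0 r1 s1 e).
rewrite edge_cell_id ?scompA //; symmetry; exact: comp1f.
Qed.

End CommaSquares.


(** * Connection squares from min and max on Delta^1 *)

Definition mono_min m (a b : mono m 1) : mono m 1.
Proof.
exists (fun i => if a i <= b i then a i else b i).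
abstract (move=> i j ij; have := mono_homo a ij; have := mono_homo b ij;
  case: (leqP (a i) (b i)); case: (leqP (a j) (b j)) => // h h' hb ha; [exact: leq_trans hb|exact: leq_trans (ltnW h') ha]).
Defined.

Definition mono_max m (a b : mono m 1) : mono m 1.
Proof.
exists (fun i => if a i <= b i then b i else a i).
abstract (move=> i j ij; have := mono_homo a ij; have := mono_homo b ij;
  case: (leqP (a i) (b i)); case: (leqP (a j) (b j)) => // h h' hb ha; [exact: leq_trans hb (ltnW h)|exact: leq_trans ha h]).
Defined.

Section Connections.
Variables (X C : sset) (t : smap (sprod X D1) C).

(** In the inner direction this runs from the identity at the source of [t] to [t], with the source
    fixed. *)
Definition conn_min : smap (sprod (sprod X D1) D1) C.
Proof.
exists (fun n y => t n (y.1.1, mono_min y.1.2 y.2)).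
abstract (by move=> m n a [[x r] s] /=; rewrite -smap_nat; congr (t _ (_, _));
  apply: mono_ext).
Defined.

(** In the inner direction this runs from [t] to the identity at its target, with the target
    fixed. *)
Definition conn_max : smap (sprod (sprod X D1) D1) C.
Proof.
exists (fun n y => t n (y.1.1, mono_max y.1.2 y.2)).
abstract (by move=> m n a [[x r] s] /=; rewrite -smap_nat; congr (t _ (_, _));
  apply: mono_ext).
Defined.

Lemma ord2_le_max (i : 'I_2) : i <= (ord_max : 'I_2).
Proof. by case: i. Qed.

Lemma conn_min_src : conn_min \os vert _ ord0 = t \os vert X ord0 \os sfst X D1.
Proof.
apply: smap_ext => n [x s] /=; congr (t _ (_, _)); apply: mono_ext => i /=.
by rewrite leqn0; case: eqP => // h; apply: val_inj.
Qed.

Lemma conn_min_tgt : conn_min \os vert _ ord_max = t.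
Proof.
apply: smap_ext => n [x s] /=; congr (t _ (_, _)); apply: mono_ext => i /=.
by rewrite ord2_le_max.
Qed.

Lemma conn_min_left :
  conn_min \os smul (vert X ord0) (sid D1) = t \os vert X ord0 \os sfst X D1.
Proof. by apply: smap_ext => n [x s] /=; congr (t _ (_, _)); apply: mono_ext. Qed.

Lemma conn_min_right : conn_min \os smul (vert X ord_max) (sid D1) = t.
Proof.
apply: smap_ext => n [x s] /=; congr (t _ (_, _)); apply: mono_ext => i /=.
by case: leqP => // h; apply/eqP; rewrite eq_sym -val_eqE eqn_leq ord2_le_max h.
Qed.

Lemma conn_max_src : conn_max \os vert _ ord0 = t.
Proof.
apply: smap_ext => n [x s] /=; congr (t _ (_, _)); apply: mono_ext => i /=.
by rewrite leqn0; case: eqP => // h; apply: val_inj.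
Qed.

Lemma conn_max_tgt :
  conn_max \os vert _ ord_max = t \os vert X ord_max \os sfst X D1.
Proof.
apply: smap_ext => n [x s] /=; congr (t _ (_, _)); apply: mono_ext => i /=.
by rewrite ord2_le_max.
Qed.

Lemma conn_max_left : conn_max \os smul (vert X ord0) (sid D1) = t.
Proof. by apply: smap_ext => n [x s] /=; congr (t _ (_, _)); apply: mono_ext. Qed.

Lemma conn_max_right :
  conn_max \os smul (vert X ord_max) (sid D1) = t \os vert X ord_max \os sfst X D1.
Proof.
apply: smap_ext => n [x s] /=; congr (t _ (_, _)); apply: mono_ext => i /=.
by case: leqP => // h; apply/eqP; rewrite -val_eqE eqn_leq ord2_le_max h.
Qed.

End Connections.

(** * Maps between comma objects: values at identity arrows, and fibred isomorphisms *)

Definition comma_left_id (A B : sset) (f : smap B A) : smap B (comma (sid A) f).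
Proof.
apply: (@comma_pair _ _ _ (sid A) f B (f \os sfst B D1) f (sid B));
  abstract exact: smap_ext.
Defined.

Definition comma_right_id (A B : sset) (u : smap A B) : smap A (comma u (sid B)).
Proof.
apply: (@comma_pair _ _ _ u (sid B) A (u \os sfst A D1) (sid A) u);
  abstract exact: smap_ext.
Defined.

(** A Yoneda argument: every [k] receives a homotopy from an identity element, and since [w]
    preserves projections, [comma_square_tgt] applies to the image of that homotopy. *)
Lemma comma_left_map (A B C : sset) (f : smap B A) (g : smap A C) (h : smap B C)
    (w : smap (comma (sid A) f) (comma g h)) X (k : smap X (comma (sid A) f))
    (a : smap X A) (b : smap X B) f01 f11 p1 q1 r0 s0 r1 s1 :
  comma_proj g h \os w = comma_proj (sid A) f ->
  comma_proj (sid A) f \os k = spair a b ->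
  @edge_cell X C (g \os comma_edge k) f01 f11 p1 q1 \oc
    @edge_cell X C (comma_edge (w \os comma_left_id f) \os smul b (sid D1))
      (h \os b) f01 r0 s0 =
  @edge_cell X C (comma_edge (w \os k)) (h \os b) f11 r1 s1.
Proof.
move=> ew ek.
have es : comma_edge k \os vert X ord0 = f \os b by exact: comma_edge_src ek.
have et : comma_edge k \os vert X ord_max = a by rewrite (comma_edge_tgt ek) scomp1f.
have c1 : conn_min (comma_edge k) \os vert _ ord_max = sid A \os comma_edge k.
  by rewrite conn_min_tgt scomp1f.
have c0 : conn_min (comma_edge k) \os vert _ ord0 = f \os (b \os sfst X D1).
  by rewrite conn_min_src es scompA.
(* The connection as a homotopy of elements, from the identity at f b to [k], over the arrow of [k]
   in A and the constant [b]. *)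
pose K := comma_pair c1 c0.
have pK : comma_proj (sid A) f \os K = spair (comma_edge k) (b \os sfst X D1).
  exact: comma_proj_pair.
have K0 : K \os vert X ord0 = comma_left_id f \os b.
  apply: comma_ext.
    by rewrite !comma_edge_comp !comma_edge_pair conn_min_left es; apply: smap_ext.
  rewrite !scompA pK comma_proj_pair.
  have -> : spair f (sid B) \os b = spair (f \os b) b by exact: smap_ext.
  by rewrite -es; apply: smap_ext.
have K1 : K \os vert X ord_max = k.
  apply: comma_ext; first by rewrite comma_edge_comp comma_edge_pair conn_min_right.
  by rewrite scompA pK ek -et; apply: smap_ext.
(* The endpoint proofs depend on the homotopies, so they are generalized before the latter are
   rewritten as the two ends of [w \os K]. *)
move: r0 s0 r1 s1; rewrite -comma_edge_comp -scompA -K0 -[in w \os k]K1 !scompA.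
move=> r0 s0 r1 s1; apply: comma_square_tgt.
by rewrite scompA ew pK.
Qed.

(** Dual argument: [conn_max] gives a homotopy from [k] to the identity at u a, over the constant
    [a], and [comma_square_src] reads off its image under [w]. *)
Lemma comma_right_map (A B C : sset) (u : smap A B) (g : smap A C) (h : smap B C)
    (w : smap (comma u (sid B)) (comma g h)) X (k : smap X (comma u (sid B)))
    (a : smap X A) (b : smap X B) f00 f10 p0 q0 r0 s0 r1 s1 :
  comma_proj g h \os w = comma_proj u (sid B) ->
  comma_proj u (sid B) \os k = spair a b ->
  @edge_cell X C (comma_edge (w \os comma_right_id u) \os smul a (sid D1))
      f10 (g \os a) r1 s1 \oc
    @edge_cell X C (h \os comma_edge k) f00 f10 p0 q0 =
  @edge_cell X C (comma_edge (w \os k)) f00 (g \os a) r0 s0.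
Proof.
move=> ew ek.
have es : comma_edge k \os vert X ord0 = b by rewrite (comma_edge_src ek) scomp1f.
have et : comma_edge k \os vert X ord_max = u \os a by exact: comma_edge_tgt ek.
have c1 : conn_max (comma_edge k) \os vert _ ord_max = u \os (a \os sfst X D1).
  by rewrite conn_max_tgt et scompA.
have c0 : conn_max (comma_edge k) \os vert _ ord0 = sid B \os comma_edge k.
  by rewrite conn_max_src scomp1f.
pose K := comma_pair c1 c0.
have pK : comma_proj u (sid B) \os K = spair (a \os sfst X D1) (comma_edge k).
  exact: comma_proj_pair.
have K0 : K \os vert X ord0 = k.
  apply: comma_ext; first by rewrite comma_edge_comp comma_edge_pair conn_max_left.
  by rewrite scompA pK ek -es; apply: smap_ext.
have K1 : K \os vert X ord_max = comma_right_id u \os a.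
  apply: comma_ext.
    by rewrite !comma_edge_comp !comma_edge_pair conn_max_right et; apply: smap_ext.
  rewrite !scompA pK comma_proj_pair.
  have -> : spair (sid A) u \os a = spair a (u \os a) by exact: smap_ext.
  by rewrite -et; apply: smap_ext.
move: r0 s0 r1 s1; rewrite -comma_edge_comp -scompA -K1 -[in w \os k]K0 !scompA.
move=> r0 s0 r1 s1; apply: comma_square_src.
by rewrite scompA ew pK.
Qed.

(** The 1-simplex in [fibred_iso], precomposed with [k], is a homotopy from [v \os k] to [v' \os k]
    over a constant one, so [comma_square_const] applies. *)
Lemma fibred_iso_edge (A B C : sset) (g : smap A C) (h : smap B C)
    (v v' : smap (comma g h) (comma g h)) X (k : smap X (comma g h))
    (a : smap X A) (b : smap X B) r0 s0 r1 s1 :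
  fibred_iso (comma_proj g h) v v' -> comma_proj g h \os k = spair a b ->
  comma_proj g h \os v = comma_proj g h ->
  @edge_cell X C (comma_edge (v \os k)) (h \os b) (g \os a) r0 s0 =
  @edge_cell X C (comma_edge (v' \os k)) (h \os b) (g \os a) r1 s1.
Proof.
case=> H [eH0 eH1 _ [y Hy]] ek ev.
have H0 : H \os vert _ ord0 = v by apply: name_inj; rewrite -src_sexp.
have H1 : H \os vert _ ord_max = v' by apply: name_inj; rewrite -tgt_sexp.
have pH : comma_proj g h \os H = comma_proj g h \os sfst _ D1.
  (* A degenerate homotopy is constant at its source end, here the projection of [v], which [ev]
     identifies with the projection itself. *)
  rewrite -[in RHS]ev -H0 scompA.
  rewrite -[_ \os H]/(sexp_post _ _ 1 H) Hy.
  by apply: smap_ext => n [x s] /=; congr (y _ (_, _)); apply: mono_ext => i; rewrite !ord1.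
pose K := H \os smul k (sid D1).
have K0 : v \os k = K \os vert X ord0 by rewrite -H0 -!scompA -vert_nat.
have K1 : v' \os k = K \os vert X ord_max by rewrite -H1 -!scompA -vert_nat.
move: r0 s0 r1 s1; rewrite K0 K1 => r0 s0 r1 s1; apply: comma_square_const.
rewrite scompA pH -scompA.
have -> : sfst _ D1 \os smul k (sid D1) = k \os sfst X D1 by exact: smap_ext.
by rewrite scompA ek; apply: smap_ext.
Qed.

(** * The triangle identities *)

Lemma left_adjoint_of_comma (A B : sset) (u : smap A B) (f : smap B A)
    (w : smap (comma (sid A) f) (comma u (sid B)))
    (w' : smap (comma u (sid B)) (comma (sid A) f)) :
  comma_proj u (sid B) \os w = comma_proj (sid A) f ->
  comma_proj (sid A) f \os w' = comma_proj u (sid B) ->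
  fibred_iso (comma_proj (sid A) f) (w' \os w) (sid _) ->
  fibred_iso (comma_proj u (sid B)) (sid _) (w \os w') ->
  left_adjoint f u.
Proof.
move=> ew ew' iso_left iso_right.
pose lid := comma_left_id f; pose rid := comma_right_id u.
have pl : comma_proj (sid A) f \os lid = spair f (sid B) by exact: comma_proj_pair.
have pr : comma_proj u (sid B) \os rid = spair (sid A) u by exact: comma_proj_pair.
have pwl : comma_proj u (sid B) \os (w \os lid) = spair f (sid B) by rewrite scompA ew.
have pwr : comma_proj (sid A) f \os (w' \os rid) = spair (sid A) u by rewrite scompA ew'.
have eta0 : comma_edge (w \os lid) \os vert B ord0 = sid B.
  by rewrite (comma_edge_src pwl) scomp1f.
have eta1 : comma_edge (w \os lid) \os vert B ord_max = u \os f by exact: comma_edge_tgt pwl.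
have eps0 : comma_edge (w' \os rid) \os vert A ord0 = f \os u by exact: comma_edge_src pwr.
have eps1 : comma_edge (w' \os rid) \os vert A ord_max = sid A.
  by rewrite (comma_edge_tgt pwr) scomp1f.
exists (edge_cell eta0 eta1), (edge_cell eps0 eps1); split.
- rewrite whisker_pre_edge whisker_post_edge.
  (* The associativity cell is absorbed into the source of the whiskered counit, so that the two
     whiskered cells become directly composable. *)
  rewrite -(compA (eqcell (scomp1f f))) edge_eqcell.
  rewrite -(compA (eqcell (scomp1f f))).
  have pk : comma_proj (sid A) f \os (w' \os (w \os lid)) = spair f (sid B).
    by rewrite scompA ew'.
  (* Taking [k] to be the unit arrow, over (f, id), collapses the composite to the class of
     w'(w(id_f)). *)
  rewrite (comma_right_map (k := w \os lid) _ _ (comma_edge_src pk) (comma_edge_tgt pk) _ _ ew' pwl).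
  have pww : comma_proj (sid A) f \os (w' \os w) = comma_proj (sid A) f.
    by rewrite scompA ew'.
  have pil : comma_proj (sid A) f \os (sid _ \os lid) = spair f (sid B).
    by rewrite scomp1f.
  move: (comma_edge_src pk) (comma_edge_tgt pk); rewrite scompA => p q.
  rewrite (fibred_iso_edge p q (comma_edge_src pil) (comma_edge_tgt pil) iso_left pl pww).
  (* Once the outer coherence cells are absorbed, what remains is the constant homotopy carried by
     [lid]. *)
  rewrite eqcell_edge edge_eqcell edge_cell_id //.
  by rewrite scomp1f comma_edge_pair.
- rewrite whisker_pre_edge whisker_post_edge.
  rewrite -(compA (eqcell (scompf1 u))) edge_eqcell.
  rewrite -(compA (eqcell (scompf1 u))).
  have pk : comma_proj u (sid B) \os (w \os (w' \os rid)) = spair (sid A) u.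
    by rewrite scompA ew.
  have pww : comma_proj u (sid B) \os sid _ = comma_proj u (sid B).
    exact: scompf1.
  have pir : comma_proj u (sid B) \os (sid _ \os rid) = spair (sid A) u.
    by rewrite scomp1f.
  (* Here [k] is the counit arrow, over (id, u), and the composite becomes the class of
     w(w'(id_u)). *)
  rewrite (comma_left_map (k := w' \os rid) _ _ _ _ (comma_edge_src pk)
    (comma_edge_tgt pk) ew pwr).
  move: (comma_edge_src pk) (comma_edge_tgt pk); rewrite scompA => p q.
  (* Used from right to left, since [iso_right] starts at the identity whereas [iso_left] ends
     there. *)
  rewrite -(fibred_iso_edge (comma_edge_src pir) (comma_edge_tgt pir) p q iso_right pr pww).
  rewrite eqcell_edge edge_eqcell edge_cell_id //.
  by rewrite scomp1f comma_edge_pair.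
Qed.

Theorem proposition4p4p3 (A B : sset) (qA : quasicategory A) (qB : quasicategory B)
    (u : smap A B) (f : smap B A)
    (fib : exists w : smap (comma_left f) (comma_right u),
       fibred_equivalence (comma_left_proj f) (comma_right_proj u) w) :
  left_adjoint f u.
Proof.
case: fib => w [ew [w' [ew' iso_left iso_right]]].
exact: (left_adjoint_of_comma ew ew' iso_left iso_right).
Qed.
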